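(* Let $n=p+q$, let $h^1,\dots,h^n:\mathbb{R}^{p,q}\to\mathcal{C}\ell_{\circledS}(p,q)$ be a Clifford field vector and $C_1,\dots,C_n:\mathbb{R}^{p,q}\to\mathcal{C}\ell_{\circledS}(p,q)$ (all with continuous partial derivatives up to second order) satisfying $\partial_\mu h_\rho-[C_\mu,h_\rho]=0$ for all $\mu,\rho$. Let $\sigma,\varepsilon\in\mathbb{C}$ with $\varepsilon=4(n-1)\sigma^3$. Define $B_\mu=\sigma h_\mu+C_\mu$ and $G_{\mu\nu}=\partial_\mu B_\nu-\partial_\nu B_\mu-[B_\mu,B_\nu]$. Then $B_\mu\in\mathcal{C}\ell_{\circledS}(p,q)$ and the Yang–Mills equations $$\partial_\mu B_\nu-\partial_\nu B_\mu-[B_\mu,B_\nu]=G_{\mu\nu},\qquad \partial_\mu G^{\mu\nu}-[B_\mu,G^{\mu\nu}]=\varepsilon h^\nu\quad(\nu=1,\dots,n)$$ hold, where $G^{\mu\nu}=\eta^{\mu\alpha}\eta^{\nu\beta}G_{\alpha\beta}$ and summation over $\mu$ is implied.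
   Context: $\mathbb{R}^{p,q}$ is $\mathbb{R}^n$ with Cartesian coordinates $x^\mu$, $\partial_\mu=\partial/\partial x^\mu$, metric $\eta=(\eta_{\mu\nu})=(\eta^{\mu\nu})=\mathrm{diag}(1,\dots,1,-1,\dots,-1)$ ($p$ ones, $q$ minus ones); indices are lowered/raised with $\eta$ (e.g. $h_\mu=\eta_{\mu\nu}h^\nu$) and Einstein summation is used. $\mathcal{C}\ell(p,q)$ is the complex Clifford algebra with identity $e$ and generators $e^1,\dots,e^n$, $e^ae^b+e^be^a=2\eta^{ab}e$, with basis $e$, $e^{a_1\dots a_k}=e^{a_1}\cdots e^{a_k}$ ($a_1<\dots<a_k$); functions into it are differentiated coefficientwise. $[U,V]=UV-VU$. $\mathrm{Tr}(U)$ is the coefficient of $e$. The center is spanned by $e$ for even $n$ and by $e,e^{1\dots n}$ for odd $n$; $\mathcal{C}\ell_{\circledS}(p,q)$ is the set of elements with zero projection onto the center. A Clifford field vector is a collection $h^\mu:\mathbb{R}^{p,q}\to\mathcal{C}\ell(p,q)$, $\mu=1,\dots,n$, with $h^\mu h^\nu+h^\nu h^\mu=2\eta^{\mu\nu}e$ and $\mathrm{Tr}(h^1\cdots h^n)=0$ at every point. *)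

(* Defs.v *)
From HB Require Import structures.
From mathcomp Require Import all_boot all_order all_algebra.
From mathcomp Require Import all_classical all_reals all_analysis.
From mathcomp Require Export complex.
Set Implicit Arguments. Unset Strict Implicit. Unset Printing Implicit Defensive.
Import GRing.Theory Num.Theory numFieldNormedType.Exports.
Local Open Scope classical_set_scope.
Local Open Scope ring_scope.

Section Clifford.
Variable R : realType.
Variables p q : nat.
Local Notation n := (p + q)%N.
Local Notation C := R[i].

(* The complex Clifford algebra Cl(p,q): an element is its family of
   coefficients on the basis blades e^A = e^{a_1} ... e^{a_k} (a_1<...<a_k),
   a blade being indexed by the set A = {a_1,...,a_k} of 'I_n;
   the identity e is the blade indexed by set0. *)
Definition Cl := {ffun {set 'I_n} -> C}.

(* diagonal of the metric eta = diag(1,..,1,-1,..,-1) (p ones, q minus ones);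
   eta_{mu mu} = eta^{mu mu}. *)
Definition eta (i : 'I_n) : C := if (i < p)%N then 1 else -1.

Definition clbasis (A : {set 'I_n}) : Cl := [ffun S => (S == A)%:R].

Definition clone : Cl := clbasis finset.set0.

Definition symdiff (A B : {set 'I_n}) : {set 'I_n} := (A :\: B) :|: (B :\: A).

(* e^A e^B = blade_sign A B * e^(A sym.diff. B), obtained from
   e^a e^b + e^b e^a = 2 eta^{ab} e. *)
Definition blade_sign (A B : {set 'I_n}) : C :=
  (-1) ^+ #|[set ab : 'I_n * 'I_n | [&& ab.1 \in A, ab.2 \in B & (ab.2 < ab.1)%N]]|
  * \prod_(i in A :&: B) eta i.

Definition clmul (U V : Cl) : Cl :=
  \sum_(A : {set 'I_n}) \sum_(B : {set 'I_n})
     (U A * V B * blade_sign A B) *: clbasis (symdiff A B).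

Definition clprod (s : seq Cl) : Cl := foldr clmul clone s.

Definition clcomm (U V : Cl) : Cl := clmul U V - clmul V U.

Definition clTr (U : Cl) : C := U finset.set0.

(* the set Cl_(S)(p,q): zero projection onto the center, which is spanned by
   e for even n and by e, e^{1...n} for odd n *)
Definition in_clS (U : Cl) : Prop :=
  U finset.set0 = 0 /\ (odd n -> U (finset.setT : {set 'I_n}) = 0).

Definition unitv (mu : 'I_n) : 'rV[R]_n := delta_mx 0 mu.

Definition pdR (mu : 'I_n) (g : 'rV[R]_n -> R) : 'rV[R]_n -> R :=
  fun x => 'D_(unitv mu) g x.

Definition C2R (g : 'rV[R]_n -> R) : Prop :=
  continuous g /\
  (forall mu x, derivable g x (unitv mu)) /\
  (forall mu, continuous (pdR mu g)) /\
  (forall mu nu x, derivable (pdR mu g) x (unitv nu)) /\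
  (forall mu nu, continuous (pdR nu (pdR mu g))).

Definition clpartial (mu : 'I_n) (F : 'rV[R]_n -> Cl) : 'rV[R]_n -> Cl :=
  fun x => [ffun A => Complex (pdR mu (fun y => complex.Re (F y A)) x)
                              (pdR mu (fun y => complex.Im (F y A)) x)].

Definition C2Cl (F : 'rV[R]_n -> Cl) : Prop :=
  forall A, C2R (fun y => complex.Re (F y A)) /\ C2R (fun y => complex.Im (F y A)).

(* Clifford field vector h^1,...,h^n (upper indices) *)
Definition clifford_field_vector (h : 'I_n -> 'rV[R]_n -> Cl) : Prop :=
  forall x,
    (forall mu nu, clmul (h mu x) (h nu x) + clmul (h nu x) (h mu x)
                   = ((2 : C) * (if mu == nu then eta mu else 0)) *: clone)
    /\ clTr (clprod [seq h mu x | mu <- enum 'I_n]) = 0.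

Definition lower (h : 'I_n -> 'rV[R]_n -> Cl) (mu : 'I_n) : 'rV[R]_n -> Cl :=
  fun x => eta mu *: h mu x.

Definition YM_B (sigma : C) (h Cf : 'I_n -> 'rV[R]_n -> Cl) (mu : 'I_n)
  : 'rV[R]_n -> Cl :=
  fun x => sigma *: lower h mu x + Cf mu x.

Definition YM_G (B : 'I_n -> 'rV[R]_n -> Cl) (mu nu : 'I_n) : 'rV[R]_n -> Cl :=
  fun x => clpartial mu (B nu) x - clpartial nu (B mu) x - clcomm (B mu x) (B nu x).

Definition YM_Gup (B : 'I_n -> 'rV[R]_n -> Cl) (mu nu : 'I_n) : 'rV[R]_n -> Cl :=
  fun x => (eta mu * eta nu) *: YM_G B mu nu x.

End Clifford.

(* Main.v *)
(** By the trace condition the ordered products [h^A] are orthonormal, up to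
    signs, for the trace form, hence a basis of the Clifford algebra; so an
    element commuting with every [h^mu] is central, and vanishes if it has no
    central part.  Differentiating [d_mu h = [C_mu, h]] once more, equality of
    mixed partials and the Jacobi identity show that the curvature of [C] is
    such an element, hence zero.  As [sigma h_mu] is covariantly constant for
    [C], this leaves [G^{mu nu} = - sigma^2 [h^mu, h^nu]], which is again
    covariantly constant; only [- sigma [h_mu, G^{mu nu}]] survives in the
    divergence, and each [mu <> nu] contributes [4 sigma^3 h^nu]. *)

From HB Require Import structures.
From mathcomp Require Import all_boot all_order all_algebra.
From mathcomp Require Import all_classical all_reals all_analysis.
From mathcomp Require Import complex ring.
Require Import Defs.
Import Order.TTheory GRing.Theory Num.Theory numFieldNormedType.Exports.
Import boot.finset.
Local Open Scope ring_scope.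

Set Implicit Arguments.
Unset Strict Implicit.
Unset Printing Implicit Defensive.

Lemma fintype_mulmx1C (K : comPzRingType) (I : finType) (M N : I -> I -> K) :
    (forall i k, \sum_j M i j * N j k = (i == k)%:R) ->
  forall i k, \sum_j N i j * M j k = (i == k)%:R.
Proof.
pose mx (F : I -> I -> K) :=
  \matrix_(i < #|I|, j < #|I|) F (enum_val i) (enum_val j).
have mxM F G i k : (mx F *m mx G) i k =
    \sum_j F (enum_val i) j * G j (enum_val k).
  rewrite mxE [RHS](reindex _ (onW_bij _ (enum_val_bij I))).
  by apply: eq_bigr => j _; rewrite !mxE.
move=> MN i k; have /mulmx1C : mx M *m mx N = 1%:M.
  by apply/matrixP => i' k'; rewrite mxM MN mxE (inj_eq enum_val_inj).
move=> /matrixP/(_ (enum_rank i) (enum_rank k)).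
by rewrite mxM !enum_rankK mxE (inj_eq enum_rank_inj).
Qed.

Lemma commutator_jacobi (A : pzRingType) (x y z : A) :
  x * (y * z - z * y) - (y * z - z * y) * x =
  (x * y - y * x) * z - z * (x * y - y * x) +
  (y * (x * z - z * x) - (x * z - z * x) * y).
Proof.
rewrite !(mulrBl, mulrBr) !opprB !mulrA.
by rewrite [RHS]addrACA !subrKA addrACA [X in _ + X]addrC -addrACA.
Qed.

Lemma anticommuting_double_commutator (A : pzRingType) (x y : A) :
    x * y = - (y * x) ->
  x * (x * y - y * x) - (x * y - y * x) * x = (x * x * y) *+ 4.
Proof.
move=> xy; have yx : y * x = - (x * y) by rewrite xy opprK.
rewrite yx opprK -mulr2n mulrnAr mulrnAl -[x * y * x]mulrA yx mulrN mulNrn.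
by rewrite opprK -mulrnDr -mulrA.
Qed.

Lemma sum_neq_natr (K : pzRingType) (I : finType) (i : I) :
  \sum_j (j != i)%:R = #|I|%:R - 1 :> K.
Proof.
apply: (addIr 1); rewrite subrK -sum1_card natr_sum.
rewrite (bigD1 i) // [in RHS](bigD1 i) //= eqxx add0r addrC; congr (_ + _).
by apply: eq_bigr => j ->.
Qed.

Section SymmetricDifference.
Variables p q : nat.
Local Notation n := (p + q)%N.
Implicit Types (A B : {set 'I_n}).

Lemma in_symdiff A B i : (i \in symdiff A B) = (i \in A) (+) (i \in B).
Proof. by rewrite !inE; case: (i \in A); case: (i \in B). Qed.

Lemma symdiffC : commutative (@symdiff p q).
Proof. by move=> A B; apply/setP => i; rewrite !in_symdiff addbC. Qed.

Lemma symdiffA : associative (@symdiff p q).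
Proof. by move=> A B D; apply/setP => i; rewrite !in_symdiff addbA. Qed.

Lemma symdiff0s : left_id set0 (@symdiff p q).
Proof. by move=> A; apply/setP => i; rewrite in_symdiff inE. Qed.

Lemma symdiffs0 : right_id set0 (@symdiff p q).
Proof. by move=> A; rewrite symdiffC symdiff0s. Qed.

Lemma symdiffxx : self_inverse set0 (@symdiff p q).
Proof. by move=> A; apply/setP => i; rewrite in_symdiff inE addbb. Qed.

Lemma symdiffK A : involutive (symdiff A).
Proof. by move=> B; rewrite symdiffA symdiffxx symdiff0s. Qed.

Lemma symdiff_eq A B D : (symdiff A B == D) = (B == symdiff A D).
Proof. by rewrite -(inj_eq (inv_inj (symdiffK A))) symdiffK. Qed.

Lemma symdiff_ind (P : {set 'I_n} -> Prop) :
    P set0 -> (forall i A, P A -> P (symdiff [set i] A)) ->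
  forall A, P A.
Proof.
move=> Pset0 Psymdiff A; have [m] := ubnP #|A|; elim: m A => // m IHm A ltAm.
have [->//|[i iA]] := set_0Vmem A.
rewrite -(symdiffK [set i] A); apply/Psymdiff/IHm.
have -> : symdiff [set i] A = A :\ i.
  by apply/setP => j; rewrite in_symdiff !inE; case: eqP => // ->; rewrite iA.
by move: ltAm; rewrite (cardsD1 i) iA.
Qed.

Lemma prod_symdiff (K : comPzRingType) (f : 'I_n -> K) A B :
    (forall i, f i * f i = 1) ->
  \prod_(i in symdiff A B) f i = (\prod_(i in A) f i) * \prod_(i in B) f i.
Proof.
move=> ff1; rewrite !(big_mkcond (fun i => i \in _)) -big_split /=.
apply: eq_bigr => i _; rewrite in_symdiff.
by case: (i \in A); case: (i \in B); rewrite /= ?mulr1 ?mul1r ?ff1.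
Qed.

End SymmetricDifference.

Section BladeSign.
Variables (R : realType) (p q : nat).
Local Notation n := (p + q)%N.
Local Notation C := R[i].
Implicit Types (A B D : {set 'I_n}).

Definition gen_sign (i j : 'I_n) : C :=
  (-1) ^+ (j < i)%N * eta R i ^+ (i == j).

Lemma eta_sqr (i : 'I_n) : eta R i * eta R i = 1.
Proof. by rewrite /eta; case: ifP => _; rewrite ?mulrNN mulr1. Qed.

Lemma gen_sign_sqr i j : gen_sign i j * gen_sign i j = 1.
Proof.
rewrite /gen_sign mulrACA -!expr2 sqrr_sign mul1r -exprM mulnC exprM.
by rewrite expr2 eta_sqr expr1n.
Qed.

Lemma gen_signC i j : gen_sign i j = (-1) ^+ (i != j) * gen_sign j i.
Proof.
rewrite /gen_sign (eq_sym j i) -val_eqE mulrA -signr_addb.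
by case: ltngtP => [||/val_inj ->].
Qed.

Lemma blade_signE A B :
  blade_sign R A B = \prod_(i in A) \prod_(j in B) gen_sign i j.
Proof.
under eq_bigr do rewrite big_split.
rewrite big_split /blade_sign; congr (_ * _).
  rewrite pair_big -sum1_card -prodrXr [LHS]big_mkcond [RHS]big_mkcond.
  apply: eq_bigr => -[i j] _ /=; rewrite [_ \in classical_sets.in_set _]asboolb.
  by case: (i \in A); case: (j \in B); case: (j < i)%N.
rewrite (eq_bigl (fun i => (i \in A) && (i \in B))) => [|i]; last first.
  exact: in_setI.
rewrite big_mkcondr; apply: eq_bigr => i _.
rewrite big_mkcond (bigD1 i) //= eqxx big1 ?mulr1 // => j /negPf.
by rewrite eq_sym => ->; case: ifP.
Qed.

Lemma blade_sign_symdiffl A B D :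
  blade_sign R (symdiff A B) D = blade_sign R A D * blade_sign R B D.
Proof.
rewrite !blade_signE; apply: prod_symdiff => i.
by rewrite -big_split big1 // => j _; exact: gen_sign_sqr.
Qed.

Lemma blade_sign_symdiffr A B D :
  blade_sign R D (symdiff A B) = blade_sign R D A * blade_sign R D B.
Proof.
rewrite !blade_signE -big_split; apply: eq_bigr => i _.
by apply: prod_symdiff => j; exact: gen_sign_sqr.
Qed.

Lemma blade_sign0l A : blade_sign R set0 A = 1.
Proof. by rewrite blade_signE big_set0. Qed.

Lemma blade_sign0r A : blade_sign R A set0 = 1.
Proof. by rewrite blade_signE big1 // => i _; rewrite big_set0. Qed.

Lemma blade_sign_sqr A B : blade_sign R A B * blade_sign R A B = 1.
Proof. by rewrite -blade_sign_symdiffl symdiffxx blade_sign0l. Qed.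

Lemma blade_sign_neq0 A B : blade_sign R A B != 0.
Proof.
apply: contra_eq_neq (blade_sign_sqr A B) => ->.
by rewrite mul0r eq_sym oner_eq0.
Qed.

Lemma blade_signC A B :
  blade_sign R A B = (-1) ^+ (#|A| * #|B| + #|A :&: B|) * blade_sign R B A.
Proof.
have row_sign i :
    \prod_(j in B) (-1) ^+ (i != j) = (-1) ^+ (#|B| + (i \in B)) :> C.
  rewrite prodrXr (cardsD1 i) addnAC addnn exprD -(mul2n (i \in B)) exprM sqrrN.
  rewrite !expr1n mul1r -sum1_card; congr (_ ^+ _).
  rewrite [LHS]big_mkcond [RHS]big_mkcond; apply: eq_bigr => j _.
  by rewrite !inE eq_sym; case: (j \in B); case: eqP.
have -> : (-1) ^+ (#|A| * #|B| + #|A :&: B|) =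
    \prod_(i in A) \prod_(j in B) (-1) ^+ (i != j) :> C.
  under eq_bigr do rewrite row_sign.
  rewrite prodrXr big_split sum_nat_const; congr (_ ^+ (_ + _)).
  rewrite -sum1_card (eq_bigl (fun i => (i \in A) && (i \in B))) => [|i].
    by rewrite big_mkcondr; apply: eq_bigr => i _; case: (i \in B).
  exact: in_setI.
rewrite !blade_signE [X in _ = _ * X]exchange_big -big_split.
apply: eq_bigr => i _; rewrite -big_split; apply: eq_bigr => j _.
exact: gen_signC.
Qed.

End BladeSign.

Section CliffordAlgebra.
Variables (R : realType) (p q : nat).
Local Notation n := (p + q)%N.
Local Notation C := R[i].
Local Notation Cl := (Cl R p q).
Local Notation e := (@clbasis R p q).
Implicit Types (A B S : {set 'I_n}) (U V W : Cl) (a : C).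

HB.instance Definition _ := GRing.Lmodule.copy Cl {ffun {set 'I_n} -> C}.

Lemma clDE U V S : (U + V) S = U S + V S. Proof. by rewrite ffunE. Qed.

Lemma clNE U S : (- U) S = - U S. Proof. by rewrite ffunE. Qed.

Lemma clZE a U S : (a *: U) S = a * U S. Proof. by rewrite ffunE. Qed.

Lemma cl_sumE I (r : seq I) (P : pred I) (F : I -> Cl) S :
  (\sum_(i <- r | P i) F i) S = \sum_(i <- r | P i) F i S.
Proof. by elim/big_rec2: _ => [|i y U _ <-]; rewrite ffunE. Qed.

Lemma clbasisE A S : e A S = (S == A)%:R. Proof. by rewrite ffunE. Qed.

Lemma clbasis_sum U : U = \sum_A U A *: e A.
Proof.
apply/ffunP => S; rewrite cl_sumE (bigD1 S) //= big1 => [|A AS].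
  by rewrite clZE clbasisE eqxx mulr1 addr0.
by rewrite clZE clbasisE eq_sym (negPf AS) mulr0.
Qed.

Lemma clmul_coef U V S :
  clmul U V S = \sum_A U A * V (symdiff A S) * blade_sign R A (symdiff A S).
Proof.
rewrite /clmul cl_sumE; apply: eq_bigr => A _.
rewrite cl_sumE (bigD1 (symdiff A S)) //= big1 => [|B].
  by rewrite clZE clbasisE symdiffK eqxx mulr1 addr0.
by rewrite clZE clbasisE eq_sym symdiff_eq => /negPf ->; rewrite mulr0.
Qed.

Lemma clmulA : associative (@clmul R p q).
Proof.
move=> U V W; apply/ffunP => S; rewrite !clmul_coef.
under [RHS]eq_bigr do rewrite clmul_coef !mulr_suml.
rewrite [RHS]exchange_big; apply: eq_bigr => A _.
rewrite clmul_coef mulr_sumr mulr_suml.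
rewrite [RHS](reindex_inj (inv_inj (symdiffK A))); apply: eq_bigr => B _.
rewrite symdiffK !symdiffA (symdiffC B A) -!(symdiffA _ _ S).
rewrite blade_sign_symdiffl !blade_sign_symdiffr.
ring: (blade_sign_sqr R A B).
Qed.

Lemma clmul1l : left_id (clone R p q) (@clmul R p q).
Proof.
move=> U; apply/ffunP => S; rewrite clmul_coef (bigD1 set0) //= big1 => [|A A0].
  by rewrite clbasisE eqxx symdiff0s blade_sign0l mulr1 mul1r addr0.
by rewrite clbasisE (negPf A0) !mul0r.
Qed.

Lemma clmul1r : right_id (clone R p q) (@clmul R p q).
Proof.
move=> U; apply/ffunP => S; rewrite clmul_coef (bigD1 S) //= big1 => [|A AS].
  by rewrite symdiffxx clbasisE eqxx blade_sign0r !mulr1 addr0.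
by rewrite clbasisE symdiff_eq symdiffs0 eq_sym (negPf AS) mulr0 mul0r.
Qed.

Lemma clmulDl : left_distributive (@clmul R p q) +%R.
Proof.
move=> U V W; apply/ffunP => S; rewrite [LHS]clmul_coef [RHS]clDE.
rewrite 2![in RHS]clmul_coef -[RHS]big_split.
by apply: eq_bigr => A _; rewrite clDE !mulrDl.
Qed.

Lemma clmulDr : right_distributive (@clmul R p q) +%R.
Proof.
move=> U V W; apply/ffunP => S; rewrite [LHS]clmul_coef [RHS]clDE.
rewrite 2![in RHS]clmul_coef -[RHS]big_split.
by apply: eq_bigr => A _; rewrite clDE mulrDr mulrDl.
Qed.

Lemma clone_neq0 : clone R p q != 0.
Proof.
apply/eqP => /ffunP/(_ set0); rewrite clbasisE eqxx ffunE.
exact/eqP/oner_neq0.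
Qed.

Lemma clmulZl a U V : a *: clmul U V = clmul (a *: U) V.
Proof.
apply/ffunP => S; rewrite [RHS]clmul_coef [LHS]clZE [in LHS]clmul_coef.
rewrite [LHS]mulr_sumr.
by apply: eq_bigr => A _; rewrite clZE !mulrA.
Qed.

Lemma clmulZr a U V : a *: clmul U V = clmul U (a *: V).
Proof.
apply/ffunP => S; rewrite [RHS]clmul_coef [LHS]clZE [in LHS]clmul_coef.
rewrite [LHS]mulr_sumr.
by apply: eq_bigr => A _; rewrite clZE !mulrA (mulrC a).
Qed.

HB.instance Definition _ := GRing.Zmodule_isNzRing.Build Cl
  clmulA clmul1l clmul1r clmulDl clmulDr clone_neq0.

HB.instance Definition _ := GRing.Lmodule_isLalgebra.Build _ Cl clmulZl.

HB.instance Definition _ := GRing.Lalgebra_isAlgebra.Build _ Cl clmulZr.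

Lemma clprodE (s : seq Cl) : clprod s = \prod_(U <- s) U.
Proof. by elim: s => [|U s IHs]; rewrite ?big_nil // big_cons -IHs. Qed.

Lemma clbasisM A B : e A * e B = blade_sign R A B *: e (symdiff A B).
Proof.
apply/ffunP => S; rewrite clZE clmul_coef (bigD1 A) //= big1 => [|D DA].
  rewrite !clbasisE eqxx mul1r addr0 symdiff_eq mulrC.
  by case: eqP => [->|]; rewrite ?symdiffK ?mulr0.
by rewrite clbasisE (negPf DA) !mul0r.
Qed.

Lemma clTrZ a U : clTr (a *: U) = a * clTr U. Proof. exact: clZE. Qed.

Lemma clTr1 : clTr (1 : Cl) = 1. Proof. by rewrite /clTr clbasisE eqxx. Qed.

Lemma clTrM U V : clTr (U * V) = \sum_A U A * V A * blade_sign R A A.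
Proof.
by rewrite /clTr clmul_coef; apply: eq_bigr => A _; rewrite symdiffs0.
Qed.

Lemma clTr_mulC U V : clTr (U * V) = clTr (V * U).
Proof. by rewrite !clTrM; apply: eq_bigr => A _; rewrite (mulrC (U A)). Qed.

Lemma clTr_mul_basis U A : clTr (U * e A) = U A * blade_sign R A A.
Proof.
rewrite clTrM (bigD1 A) //= big1 => [|B BA].
  by rewrite clbasisE eqxx mulr1 addr0.
by rewrite clbasisE (negPf BA) mulr0 mul0r.
Qed.

End CliffordAlgebra.

Section CentralIndices.
Variables (R : realType) (p q : nat).
Local Notation n := (p + q)%N.
Local Notation Cl := (Cl R p q).
Local Notation e := (@clbasis R p q).
Implicit Types (A B : {set 'I_n}) (U V : Cl) (a : R[i]).

Definition central_index A := (A == set0) || odd n && (A == setT).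

Lemma central_index_blade_signC A B :
  central_index A -> blade_sign R A B = blade_sign R B A.
Proof.
case/orP => [/eqP ->|/andP[odd_n /eqP ->]].
  by rewrite blade_sign0l blade_sign0r.
rewrite blade_signC setTI cardsT card_ord -mulSnr -signr_odd oddM /= odd_n.
by rewrite mul1r.
Qed.

Lemma exists_anticommuting_generator A : ~~ central_index A ->
  exists i : 'I_n, blade_sign R [set i] A = - blade_sign R A [set i].
Proof.
rewrite negb_or negb_and => /andP[/set0Pn[i0 i0A] Atop].
suff [i odd_i] : exists i : 'I_n, odd (#|A| + (i \in A)).
  exists i; rewrite blade_signC cards1 mul1n (_ : #|_ :&: A| = (i \in A)).
    by rewrite -signr_odd odd_i mulN1r.
  have [iA|iA] := boolP (i \in A).
    by rewrite (setIidPl _) ?cards1 ?sub1set.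
  by apply/eqP; rewrite cards_eq0 setI_eq0 disjoints1.
have [odd_A|even_A] := boolP (odd #|A|); last first.
  by exists i0; rewrite i0A oddD (negPf even_A).
have [AC0|[i iAC]] := set_0Vmem (~: A); last first.
  by exists i; move: iAC; rewrite inE => /negPf ->; rewrite addn0.
have AT : A = setT by rewrite -(setCK A) AC0 setC0.
by move: odd_A Atop; rewrite AT cardsT card_ord eqxx => ->.
Qed.

Lemma in_clSP U : in_clS U <-> forall A, central_index A -> U A = 0.
Proof.
split=> [[U0 UT] A /orP[/eqP -> //|/andP[odd_n /eqP ->]]|Uc]; first exact: UT.
by split=> [|odd_n]; apply: Uc; rewrite /central_index ?odd_n eqxx ?orbT.
Qed.

Lemma in_clSD U V : in_clS U -> in_clS V -> in_clS (U + V).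
Proof.
move=> /in_clSP US /in_clSP VS; apply/in_clSP => A Ac.
by rewrite clDE US ?VS ?addr0.
Qed.

Lemma in_clSZ a U : in_clS U -> in_clS (a *: U).
Proof.
by move=> /in_clSP US; apply/in_clSP => A Ac; rewrite clZE US ?mulr0.
Qed.

Lemma in_clSB U V : in_clS U -> in_clS V -> in_clS (U - V).
Proof. by move=> US VS; rewrite -scaleN1r; apply/in_clSD/in_clSZ. Qed.

Lemma clbasis_central A V : central_index A -> V * e A = e A * V.
Proof.
move=> Ac; rewrite (clbasis_sum V) mulr_suml mulr_sumr; apply: eq_bigr => B _.
rewrite -scalerAl -scalerAr !clbasisM symdiffC.
by rewrite (central_index_blade_signC B Ac).
Qed.

Lemma clmul_central_coefC A U V : central_index A -> (U * V) A = (V * U) A.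
Proof.
move=> Ac; apply: (mulIf (blade_sign_neq0 R A A)); rewrite -!clTr_mul_basis.
by rewrite -[in LHS](mulrA U) (clbasis_central V Ac) mulrA [LHS]clTr_mulC mulrA.
Qed.

End CentralIndices.

Section Commutator.
Variables (R : realType) (p q : nat).
Implicit Types (U V W : Cl R p q) (a : R[i]).

Lemma clcommE U V : clcomm U V = U * V - V * U. Proof. by []. Qed.

Lemma clcommC U V : clcomm U V = - clcomm V U.
Proof. by rewrite !clcommE opprB. Qed.

Lemma clcommDl U V W : clcomm (U + V) W = clcomm U W + clcomm V W.
Proof. by rewrite !clcommE mulrDl mulrDr opprD addrACA. Qed.

Lemma clcommDr U V W : clcomm W (U + V) = clcomm W U + clcomm W V.
Proof. by rewrite !clcommE mulrDl mulrDr opprD addrACA. Qed.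

Lemma clcommZl a U V : clcomm (a *: U) V = a *: clcomm U V.
Proof. by rewrite !clcommE -scalerAl -scalerAr -scalerBr. Qed.

Lemma clcommZr a U V : clcomm V (a *: U) = a *: clcomm V U.
Proof. by rewrite !clcommE -scalerAl -scalerAr -scalerBr. Qed.

Lemma clcommBl U V W : clcomm (U - V) W = clcomm U W - clcomm V W.
Proof. by rewrite clcommDl -[- V]scaleN1r clcommZl scaleN1r. Qed.

Lemma clcomm_jacobi U V W :
  clcomm U (clcomm V W) = clcomm (clcomm U V) W + clcomm V (clcomm U W).
Proof. exact: commutator_jacobi. Qed.

Lemma in_clS_clcomm U V : in_clS (clcomm U V).
Proof.
apply/in_clSP => A Ac; rewrite clcommE clDE clNE.
by rewrite (clmul_central_coefC U V Ac) subrr.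
Qed.

End Commutator.

Section BladeSystem.
Variables (R : realType) (p q : nat).
Local Notation n := (p + q)%N.
Local Notation Cl := (Cl R p q).
Implicit Types (A B : {set 'I_n}) (U V : Cl).

Variable blade : {set 'I_n} -> Cl.
Hypothesis blade0 : blade set0 = 1.
Hypothesis blade1M : forall i A,
  blade [set i] * blade A = blade_sign R [set i] A *: blade (symdiff [set i] A).

Lemma blade_symdiff1 i A : blade (symdiff [set i] A) =
  blade_sign R [set i] A *: (blade [set i] * blade A).
Proof. by rewrite blade1M scalerA blade_sign_sqr scale1r. Qed.

(* As [blade_sign] is multiplicative in each argument, the products of one
   generator with a blade determine all products of blades. *)
Lemma bladeM A B :
  blade A * blade B = blade_sign R A B *: blade (symdiff A B).
Proof.
elim/symdiff_ind: A => [|i A IHA].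
  by rewrite blade0 mul1r blade_sign0l symdiff0s scale1r.
rewrite blade_symdiff1 -scalerAl -mulrA IHA -scalerAr blade1M !scalerA symdiffA.
rewrite blade_sign_symdiffr blade_sign_symdiffl; congr (_ *: _).
ring: (blade_sign_sqr R [set i] A).
Qed.

Lemma clTr_mul_blade_eq0 U A : ~~ central_index A ->
  (forall i, U * blade [set i] = blade [set i] * U) -> clTr (U * blade A) = 0.
Proof.
move=> Anc Ub; have [i anti_i] := exists_anticommuting_generator R Anc.
pose h := blade [set i]; pose c := blade_sign R [set i] [set i].
have hh : h * h = c%:A by rewrite bladeM symdiffxx blade0.
have hA : h * blade A = - (blade A * h).
  by rewrite !bladeM anti_i symdiffC scaleNr.
have trace_opp : clTr (U * blade A * h * h) = - clTr (U * blade A * h * h).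
  rewrite {1}clTr_mulC !mulrA -Ub -[in LHS](mulrA U) hA mulrN mulNr.
  by rewrite [LHS]clNE mulrA.
apply: (mulfI (blade_sign_neq0 R [set i] [set i])); rewrite mulr0 -clTrZ.
by apply/eqP; rewrite -eqNr -mulr_algr -hh mulrA -trace_opp.
Qed.

Hypothesis Tr_bladeT : odd n -> clTr (blade setT) = 0.

Lemma clTr_blade A : clTr (blade A) = (A == set0)%:R.
Proof.
have [->|A0] := eqVneq A set0; first by rewrite blade0 clTr1.
have [|Anc] := boolP (central_index A).
  rewrite /central_index (negPf A0) => /andP[odd_n /eqP ->].
  exact: Tr_bladeT.
by rewrite -[blade A]mul1r clTr_mul_blade_eq0 // => i; rewrite mul1r mulr1.
Qed.

Lemma clTr_bladeM A B :
  clTr (blade A * blade B) = (A == B)%:R * blade_sign R B B.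
Proof.
rewrite bladeM clTrZ clTr_blade symdiff_eq symdiffs0 eq_sym mulrC.
by case: eqP => [->|]; rewrite ?mul0r.
Qed.

(* A family orthonormal for the trace form and as large as the dimension is a
   basis: the two matrices of coefficients are inverse to each other. *)
Lemma blade_expansion U :
  U = \sum_A (clTr (U * blade A) * blade_sign R A A) *: blade A.
Proof.
pose dual S A := blade A S * blade_sign R S S * blade_sign R A A.
have right_inverse A B : \sum_S blade A S * dual S B = (A == B)%:R.
  have := congr1 ( *%R^~ (blade_sign R B B)) (clTr_bladeM A B).
  rewrite clTrM /= mulr_suml -mulrA blade_sign_sqr mulr1 => <-.
  by apply: eq_bigr => S _; rewrite /dual !mulrA.
have left_inverse := fintype_mulmx1C right_inverse.
apply/ffunP => S; rewrite [in LHS](clbasis_sum U) !cl_sumE.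
under [LHS]eq_bigr => T _ do
  rewrite clZE clbasisE eq_sym -left_inverse mulr_sumr.
rewrite exchange_big; apply: eq_bigr => A _.
rewrite clZE clTrM !mulr_suml; apply: eq_bigr => T _.
by rewrite /dual !mulrA.
Qed.

Lemma blade_centralizer_central U V :
  (forall i, U * blade [set i] = blade [set i] * U) -> U * V = V * U.
Proof.
move=> Ub; have UA A : U * blade A = blade A * U.
  elim/symdiff_ind: A => [|i A UA]; first by rewrite blade0 mulr1 mul1r.
  rewrite blade_symdiff1 -scalerAr -scalerAl mulrA Ub -[in LHS]mulrA UA.
  by rewrite mulrA.
rewrite (blade_expansion V) mulr_sumr mulr_suml; apply: eq_bigr => A _.
by rewrite -scalerAl -scalerAr UA.
Qed.

End BladeSystem.

Section CliffordGenerators.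
Variables (R : realType) (p q : nat).
Local Notation n := (p + q)%N.
Local Notation C := R[i].
Local Notation Cl := (Cl R p q).
Implicit Types (A B : {set 'I_n}) (U V : Cl).

Lemma central_in_clS_eq0 U : (forall V, U * V = V * U) -> in_clS U -> U = 0.
Proof.
move=> Uc /in_clSP US; apply/ffunP => A; rewrite [RHS]ffunE.
have [/US //|Anc] := boolP (central_index A).
have /eqP := clTr_mul_blade_eq0 (erefl : clbasis R set0 = 1)
  (fun i => clbasisM R [set i]) Anc (fun i => Uc (clbasis R [set i])).
by rewrite clTr_mul_basis mulf_eq0 (negPf (blade_sign_neq0 _ _ _)) orbF => /eqP.
Qed.

Variable g : 'I_n -> Cl.
Hypothesis g_clifford : forall i j, g i * g j + g j * g i =
  ((2 : C) * (if i == j then eta R i else 0)) *: 1.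

Lemma gen_sqr i : g i * g i = (eta R i)%:A.
Proof.
have two_neq0 : (2 : C) != 0 by rewrite pnatr_eq0.
apply: (scalerI two_neq0); rewrite scalerA scaler_nat mulr2n.
by rewrite g_clifford eqxx.
Qed.

Lemma gen_anticomm i j : i != j -> g i * g j = - (g j * g i).
Proof.
by move=> /negPf ij; apply/eqP; rewrite -addr_eq0 g_clifford ij mulr0 scale0r.
Qed.

Lemma gen_double_clcomm i j :
  clcomm (g i) (clcomm (g i) (g j)) = (4 * (i != j)%:R * eta R i) *: g j.
Proof.
have [->|ij] := eqVneq i j.
  rewrite mulr0 mul0r scale0r (_ : clcomm (g j) (g j) = 0); last exact: subrr.
  by rewrite clcommE mulr0 mul0r subrr.
rewrite !clcommE anticommuting_double_commutator; last exact: gen_anticomm.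
by rewrite gen_sqr mulr_algl -scaler_nat scalerA mulr1.
Qed.

Definition gen_blade A : Cl := \prod_(i <- enum A) g i.

Lemma gen_blade0 : gen_blade set0 = 1.
Proof. by rewrite /gen_blade enum_set0 big_nil. Qed.

Lemma gen_blade1 i : gen_blade [set i] = g i.
Proof. by rewrite /gen_blade enum_set1 big_seq1. Qed.

Lemma gen_bladeT : gen_blade setT = clprod [seq g i | i <- enum 'I_n].
Proof. by rewrite clprodE big_map /gen_blade enum_setT enumT. Qed.

(* Moving [g i] to its place in the product passes the smaller indices. *)
Lemma gen_mul_sorted_prod i A (r : seq 'I_n) :
    sorted (fun j k : 'I_n => (j < k)%N) r -> i \in r ->
  g i * \prod_(j <- r | j \in A) g j =
  (\prod_(j <- r | j \in A) gen_sign R i j) *: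
    \prod_(j <- r | j \in symdiff [set i] A) g j.
Proof.
elim: r => // k r IHr; rewrite /= path_sortedE; last first.
  by move=> ? ? ?; exact: ltn_trans.
move=> /andP[/allP lt_kr sorted_r]; rewrite inE !big_cons in_symdiff inE.
rewrite (eq_sym k); have [ik _|ik /= ir] := eqVneq i k; last first.
  have ki : (k < i)%N := lt_kr i ir.
  case: (k \in A) => /=; last exact: IHr.
  rewrite mulrA gen_anticomm // mulNr -mulrA IHr // -scalerAr.
  by rewrite /gen_sign ki (negPf ik) mulr1 mulN1r scaleNr.
rewrite -ik in lt_kr *.
have -> : \prod_(j <- r | j \in A) gen_sign R i j = 1.
  rewrite big_seq_cond big1 // => j /andP[/lt_kr ij _].
  by rewrite /gen_sign -val_eqE /= ltn_eqF // ltnNge ltnW // mulr1.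
have -> : \prod_(j <- r | j \in symdiff [set i] A) g j =
    \prod_(j <- r | j \in A) g j.
  rewrite big_seq_cond [RHS]big_seq_cond; apply: eq_bigl => j.
  case jr : (j \in r) => //=; have ij := lt_kr j jr.
  by rewrite in_symdiff inE -val_eqE /= gtn_eqF.
case: (i \in A) => /=; last by rewrite scale1r.
by rewrite mulrA gen_sqr mulr_algl /gen_sign ltnn eqxx mul1r mulr1.
Qed.

Lemma gen_blade1M i A : gen_blade [set i] * gen_blade A =
  blade_sign R [set i] A *: gen_blade (symdiff [set i] A).
Proof.
have sorted_ord : sorted (fun j k : 'I_n => (j < k)%N) (enum 'I_n).
  by rewrite -(@sorted_map _ _ val ltn) val_enum_ord iota_ltn_sorted.
have filterE B : gen_blade B = \prod_(j <- enum 'I_n | j \in B) g j.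
  by rewrite /gen_blade {1}/enum_mem big_filter enumT.
rewrite gen_blade1 !filterE gen_mul_sorted_prod ?mem_enum // blade_signE.
by rewrite big_set1 big_enum_cond.
Qed.

Hypothesis g_top : clTr (clprod [seq g i | i <- enum 'I_n]) = 0.

Lemma gen_centralizer_in_clS_eq0 U :
  (forall i, U * g i = g i * U) -> in_clS U -> U = 0.
Proof.
move=> Ug; apply: central_in_clS_eq0 => V.
apply: (blade_centralizer_central gen_blade0 gen_blade1M) => [_|i].
  by rewrite gen_bladeT.
by rewrite gen_blade1.
Qed.

End CliffordGenerators.

Section MixedPartials.
Local Open Scope classical_set_scope.
Variables (R : realType) (V : normedModType R).
Implicit Types (g : V -> R) (x u v : V) (s : R).

Lemma is_derive_translate g x v (w : V) : derivable g (x + w) v ->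
  is_derive x v (fun y => g (y + w)) ('D_v g (x + w)).
Proof.
have quotientE :
    (fun h => h^-1 *: (((fun y => g (y + w)) \o shift x) (h *: v)
                       - g (x + w))) =
    (fun h : R => h^-1 *: ((g \o shift (x + w)) (h *: v) - g (x + w))).
  by apply/funext => h /=; rewrite addrA.
by move=> dg; apply: DeriveDef; rewrite /derivable /derive quotientE.
Qed.

Lemma is_derive_line g x v s : derivable g (x + s *: v) v ->
  is_derive s 1 (fun t => g (x + t *: v)) ('D_v g (x + s *: v)).
Proof.
have quotientE :
    (fun h => h^-1 *: (((fun t => g (x + t *: v)) \o shift s) (h *: 1)
                       - g (x + s *: v))) =
    (fun h : R =>
       h^-1 *: ((g \o shift (x + s *: v)) (h *: v) - g (x + s *: v))).
  apply/funext => h /=; congr (_ *: (g _ - _)).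
  by rewrite [h *: 1]mulr1 scalerDl addrCA.
by move=> dg; apply: DeriveDef; rewrite /derivable /derive quotientE.
Qed.

Lemma directional_MVT g x v s : 0 < s -> (forall y, derivable g y v) ->
  exists2 c : R, 0 < c < s & g (x + s *: v) - g x = s * 'D_v g (x + c *: v).
Proof.
move=> s0 dg; have dline t := is_derive_line (dg (x + t *: v)).
have cline : {within `[0, s], continuous (fun t => g (x + t *: v))}.
  apply: derivable_within_continuous => t _.
  exact: (@ex_derive _ _ _ _ _ _ _ (dline t)).
have [c] := MVT s0 (fun t _ => dline t) cline.
rewrite in_itv /= => cs E; exists c => //.
by move: E; rewrite scale0r addr0 subr0 mulrC.
Qed.

Definition second_difference g x u v : R :=
  g (x + u + v) - g (x + u) - (g (x + v) - g x).

Lemma second_differenceC g x u v :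
  second_difference g x u v = second_difference g x v u.
Proof. rewrite /second_difference (addrAC x v); ring. Qed.

Lemma second_difference_MVT g x u v s : 0 < s ->
    (forall y, derivable g y u) -> (forall y, derivable ('D_u g) y v) ->
  exists2 c : R * R, 0 < c.1 < s /\ 0 < c.2 < s &
    second_difference g x (s *: u) (s *: v) =
      s ^+ 2 * 'D_v ('D_u g) (x + c.1 *: u + c.2 *: v).
Proof.
move=> s0 dg ddg; pose dv y := g (y + s *: v) - g y.
have d_dv y : is_derive y u dv ('D_u g (y + s *: v) - 'D_u g y).
  exact: is_deriveB (is_derive_translate (dg _)) (derivableP (dg y)).
have derivable_dv y := @ex_derive _ _ _ _ _ _ _ (d_dv y).
have [c cs Ec] := directional_MVT x s0 derivable_dv.
have [d ds Ed] := directional_MVT (x + c *: u) s0 ddg.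
exists (c, d) => //=.
by rewrite expr2 -mulrA -Ed -(@derive_val _ _ _ _ _ _ _ (d_dv _)) -Ec.
Qed.

Lemma cvg_at_right0_lt_id (a : R -> R) :
  (forall s, 0 < s -> 0 < a s < s) -> a s @[s --> 0^'+] --> 0.
Proof.
move=> a_lt; apply: (@squeeze_cvgr _ _ _ _ (cst 0) id).
- near=> s; have s0 : 0 < s by near: s; exact: nbhs_right_gt.
  by have /andP[/ltW -> /ltW ->] := a_lt s s0.
- exact: cvg_cst.
- exact: cvg_at_right_filter cvg_id.
Unshelve. all: by end_near. Qed.

Lemma second_difference_cvg g x u v :
    (forall y, derivable g y u) -> (forall y, derivable ('D_u g) y v) ->
    {for x, continuous ('D_v ('D_u g))} ->
  s ^- 2 * second_difference g x (s *: u) (s *: v) @[s --> 0^'+]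
    --> 'D_v ('D_u g) x.
Proof.
move=> dg ddg cg.
have /choice[c cP] s : exists c : R * R, 0 < s ->
    [/\ 0 < c.1 < s, 0 < c.2 < s &
    second_difference g x (s *: u) (s *: v) =
      s ^+ 2 * 'D_v ('D_u g) (x + c.1 *: u + c.2 *: v)].
  have [s0|_] := ltP 0 s; last by exists (0, 0).
  by have [c [? ?] ?] := second_difference_MVT x s0 dg ddg; exists c.
have cvgx : x + (c s).1 *: u + (c s).2 *: v @[s --> 0^'+] --> x.
  have cvgc1 : (c s).1 @[s --> 0^'+] --> 0.
    by apply: cvg_at_right0_lt_id => s /cP[].
  have cvgc2 : (c s).2 @[s --> 0^'+] --> 0.
    by apply: cvg_at_right0_lt_id => s /cP[].
  rewrite [X in _ --> X](_ : x = x + 0 *: u + 0 *: v); last first.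
    by rewrite !scale0r !addr0.
  exact: cvgD (cvgD (cvg_cst x) (cvgZr_tmp cvgc1)) (cvgZr_tmp cvgc2).
apply: cvg_trans (cvg_comp _ _ cvgx cg); apply: near_eq_cvg; near=> s.
have s0 : 0 < s by near: s; exact: nbhs_right_gt.
by have [_ _ ->] := cP s s0; rewrite mulKf ?expf_neq0 // gt_eqF.
Unshelve. all: by end_near. Qed.

Lemma mixed_deriveC g u v x :
    (forall y, derivable g y u) -> (forall y, derivable g y v) ->
    (forall y, derivable ('D_u g) y v) -> (forall y, derivable ('D_v g) y u) ->
    {for x, continuous ('D_v ('D_u g))} ->
    {for x, continuous ('D_u ('D_v g))} ->
  'D_v ('D_u g) x = 'D_u ('D_v g) x.
Proof.
move=> gu gv guv gvu cuv cvu.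
have swapped : s ^- 2 * second_difference g x (s *: u) (s *: v) @[s --> 0^'+]
    --> 'D_u ('D_v g) x.
  under eq_cvg do rewrite second_differenceC.
  exact: second_difference_cvg.
have straight := second_difference_cvg gu guv cuv.
exact: (cvg_unique (@norm_hausdorff _ _) straight swapped).
Qed.

End MixedPartials.

Section CliffordDerivative.
Variables (R : realType) (p q : nat).
Local Notation n := (p + q)%N.
Local Notation C := R[i].
Local Notation Cl := (Cl R p q).
Implicit Types (F G : 'rV[R]_n -> Cl) (D : Cl) (mu nu : 'I_n).

Definition is_cderive (V : normedModType R) (x v : V) (f : V -> C) (d : C) :=
  is_derive x v (fun y => complex.Re (f y)) (complex.Re d) /\
  is_derive x v (fun y => complex.Im (f y)) (complex.Im d).

Section ComplexValued.
Variable V : normedModType R.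
Implicit Types (x v : V) (f g : V -> C) (d : C).

Lemma is_cderive_cst x v (a : C) : is_cderive x v (fun=> a) 0.
Proof. by split; exact: is_derive_cst. Qed.

Lemma is_cderiveD x v f g d d' : is_cderive x v f d ->
  is_cderive x v g d' -> is_cderive x v (fun y => f y + g y) (d + d').
Proof.
move=> [fr fi] [gr gi]; split; rewrite raddfD; under eq_fun do rewrite raddfD.
  exact: is_deriveD.
exact: is_deriveD.
Qed.

Lemma is_cderiveM x v f g d d' : is_cderive x v f d -> is_cderive x v g d' ->
  is_cderive x v (fun y => f y * g y) (d * g x + f x * d').
Proof.
have ReM (a b : C) : complex.Re (a * b) =
    complex.Re a * complex.Re b - complex.Im a * complex.Im b.
  by case: a => ? ?; case: b.
have ImM (a b : C) : complex.Im (a * b) =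
    complex.Re a * complex.Im b + complex.Im a * complex.Re b.
  by case: a => ? ?; case: b.
move=> [fr fi] [gr gi]; split; rewrite raddfD /=.
- under eq_fun do rewrite ReM.
  apply: is_derive_eq (is_deriveB (is_deriveM fr gr) (is_deriveM fi gi)) _.
  by rewrite !ReM /GRing.scale /=; ring.
- under eq_fun do rewrite ImM.
  apply: is_derive_eq (is_deriveD (is_deriveM fr gi) (is_deriveM fi gr)) _.
  by rewrite !ImM /GRing.scale /=; ring.
Qed.

Lemma is_cderive_sum (I : Type) (r : seq I) x v (f : I -> V -> C) (d : I -> C) :
    (forall i, is_cderive x v (f i) (d i)) ->
  is_cderive x v (fun y => \sum_(i <- r) f i y) (\sum_(i <- r) d i).
Proof.
move=> fd; elim: r => [|i r IHr].
  by under eq_fun do rewrite big_nil; rewrite big_nil; exact: is_cderive_cst.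
by under eq_fun do rewrite big_cons; rewrite big_cons; exact: is_cderiveD.
Qed.

End ComplexValued.

Lemma clpartialE mu F x A :
  clpartial mu F x A = Complex (pdR mu (fun y => complex.Re (F y A)) x)
                               (pdR mu (fun y => complex.Im (F y A)) x).
Proof. by rewrite ffunE. Qed.

Definition is_clpartial mu F x D :=
  forall A, is_cderive x (unitv R mu) (fun y => F y A) (D A).

Lemma clpartial_val mu F x D : is_clpartial mu F x D -> clpartial mu F x = D.
Proof.
move=> FD; apply/ffunP => A; rewrite clpartialE /pdR; have [dre dim] := FD A.
rewrite (@derive_val _ _ _ _ _ _ _ dre) (@derive_val _ _ _ _ _ _ _ dim).
by case: (D A).
Qed.

Lemma C2Cl_is_clpartial mu F x :
  C2Cl F -> is_clpartial mu F x (clpartial mu F x).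
Proof.
move=> F2 A; rewrite clpartialE; have [[_ [dre _]] [_ [dim _]]] := F2 A.
by split; exact: derivableP.
Qed.

Lemma is_clpartialD mu F G x D D' : is_clpartial mu F x D ->
  is_clpartial mu G x D' -> is_clpartial mu (fun y => F y + G y) x (D + D').
Proof.
move=> FD GD A; under eq_fun do rewrite clDE.
by rewrite clDE; exact: is_cderiveD.
Qed.

Lemma is_clpartialZ mu (a : C) F x D : is_clpartial mu F x D ->
  is_clpartial mu (fun y => a *: F y) x (a *: D).
Proof.
move=> FD A; under eq_fun do rewrite clZE.
rewrite clZE -[a * _]add0r -[X in X + _](mul0r (F x A)).
by apply: is_cderiveM => //; exact: is_cderive_cst.
Qed.

Lemma is_clpartialB mu F G x D D' : is_clpartial mu F x D ->
  is_clpartial mu G x D' -> is_clpartial mu (fun y => F y - G y) x (D - D').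
Proof.
move=> FD GD; rewrite -scaleN1r; under eq_fun do rewrite -scaleN1r.
by apply: is_clpartialD => //; exact: is_clpartialZ.
Qed.

Lemma is_clpartialM mu F G x D D' : is_clpartial mu F x D ->
    is_clpartial mu G x D' ->
  is_clpartial mu (fun y => F y * G y) x (D * G x + F x * D').
Proof.
move=> FD GD S; under eq_fun do rewrite clmul_coef.
rewrite clDE !clmul_coef -big_split; apply: is_cderive_sum => A /=.
rewrite -mulrDl -[X in is_cderive _ _ _ X]addr0.
rewrite -[X in _ + X](mulr0 (F x A * G x (symdiff A S))).
by apply: is_cderiveM; [exact: is_cderiveM|exact: is_cderive_cst].
Qed.

Lemma clpartialC mu nu F x : C2Cl F ->
  clpartial mu (clpartial nu F) x = clpartial nu (clpartial mu F) x.
Proof.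
have pdRC (g : 'rV[R]_n -> R) :
    C2R g -> pdR mu (pdR nu g) x = pdR nu (pdR mu g) x.
  move=> [_ [dg [_ [ddg cddg]]]].
  exact: (mixed_deriveC (dg nu) (dg mu) (ddg nu mu) (ddg mu nu)
    (cddg nu mu x) (cddg mu nu x)).
move=> F2; apply/ffunP => A; have [reF imF] := F2 A.
have reE mu' : (fun y => complex.Re (clpartial mu' F y A)) =
    pdR mu' (fun y => complex.Re (F y A)).
  by apply/funext => y; rewrite clpartialE.
have imE mu' : (fun y => complex.Im (clpartial mu' F y A)) =
    pdR mu' (fun y => complex.Im (F y A)).
  by apply/funext => y; rewrite clpartialE.
rewrite [LHS]clpartialE [RHS]clpartialE [in LHS]reE [in LHS]imE.
by rewrite [in RHS]reE [in RHS]imE [in LHS](pdRC _ reF) [in LHS](pdRC _ imF).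
Qed.

Lemma in_clS_clpartial mu F x :
  (forall y, in_clS (F y)) -> in_clS (clpartial mu F x).
Proof.
move=> FS; apply/in_clSP => A Ac.
have F0 y : F y A = 0 by have /in_clSP := FS y; apply.
have : is_cderive x (unitv R mu) (fun y => F y A) 0.
  by under eq_fun do rewrite F0; exact: is_cderive_cst.
case=> dre dim; rewrite clpartialE /pdR.
by rewrite (@derive_val _ _ _ _ _ _ _ dre) (@derive_val _ _ _ _ _ _ _ dim).
Qed.

End CliffordDerivative.

Section Parallel.
Variables (R : realType) (p q : nat).
Local Notation n := (p + q)%N.
Local Notation Cl := (Cl R p q).
Implicit Types (F G : 'rV[R]_n -> Cl) (x : 'rV[R]_n) (mu nu : 'I_n).

Lemma is_clpartial_clcomm mu F G x D D' : is_clpartial mu F x D ->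
    is_clpartial mu G x D' ->
  is_clpartial mu (fun y => clcomm (F y) (G y)) x
    (clcomm D (G x) + clcomm (F x) D').
Proof.
move=> FD GD; rewrite !clcommE addrACA -opprD [X in _ - X]addrC.
by apply: is_clpartialB; exact: is_clpartialM.
Qed.

Variable Cf : 'I_n -> 'rV[R]_n -> Cl.

Definition parallel F :=
  forall mu x, is_clpartial mu F x (clcomm (Cf mu x) (F x)).

Lemma parallelZ a F : parallel F -> parallel (fun x => a *: F x).
Proof. by move=> Fp mu x; rewrite clcommZr; exact: is_clpartialZ. Qed.

Lemma parallel_clcomm F G :
  parallel F -> parallel G -> parallel (fun x => clcomm (F x) (G x)).
Proof.
by move=> Fp Gp mu x; rewrite clcomm_jacobi; exact: is_clpartial_clcomm.
Qed.

Lemma parallel_clpartial F mu : parallel F ->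
  clpartial mu F = fun x => clcomm (Cf mu x) (F x).
Proof. by move=> Fp; apply/funext => x; exact: clpartial_val (Fp mu x). Qed.

Lemma parallel_covariant_shift F mu x (U : Cl) : parallel F ->
  clpartial mu F x - clcomm (U + Cf mu x) (F x) = - clcomm U (F x).
Proof.
move=> Fp; rewrite (parallel_clpartial mu Fp) clcommDl opprD addrCA subrr.
exact: addr0.
Qed.

Hypothesis Cf_C2 : forall mu, C2Cl (Cf mu).

Lemma parallel_curvature F mu nu x : C2Cl F -> parallel F ->
  clcomm (YM_G Cf mu nu x) (F x) = 0.
Proof.
move=> F2 Fp; have ddF mu' nu' : clpartial mu' (clpartial nu' F) x =
    clcomm (clpartial mu' (Cf nu') x) (F x) +
    clcomm (Cf nu' x) (clcomm (Cf mu' x) (F x)).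
  rewrite (parallel_clpartial nu' Fp); apply: clpartial_val.
  exact: is_clpartial_clcomm (C2Cl_is_clpartial _ _ (Cf_C2 nu')) (Fp mu' x).
have := clpartialC mu nu x F2; rewrite !ddF (clcomm_jacobi (Cf mu x)).
rewrite [X in _ = X -> _]addrA => /addIr comm_clpartial.
by rewrite /YM_G 2!clcommBl comm_clpartial addrAC addrK subrr.
Qed.

Lemma in_clS_curvature mu nu x :
  (forall mu' y, in_clS (Cf mu' y)) -> in_clS (YM_G Cf mu nu x).
Proof.
move=> CfS; apply: in_clSB; last exact: in_clS_clcomm.
by apply: in_clSB; exact: in_clS_clpartial.
Qed.

Variable b : 'I_n -> 'rV[R]_n -> Cl.
Hypothesis b_parallel : forall mu, parallel (b mu).
Local Notation B := (fun mu x => b mu x + Cf mu x).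

Lemma YM_G_shift mu nu x :
  YM_G B mu nu x = YM_G Cf mu nu x - clcomm (b mu x) (b nu x).
Proof.
have dB mu' nu' : clpartial mu' (B nu') x =
    clcomm (Cf mu' x) (b nu' x) + clpartial mu' (Cf nu') x.
  apply: clpartial_val; apply: is_clpartialD; first exact: b_parallel.
  exact: C2Cl_is_clpartial.
rewrite /YM_G !dB clcommDl !clcommDr (clcommC (b mu x) (Cf nu x)).
move: (clcomm _ _) (clcomm _ _) (clcomm _ _) (clcomm _ _).
move: (clpartial _ _ _) (clpartial _ _ _) => ? ? ? ? ? ?.
by apply/ffunP => A; rewrite !(clDE, clNE); ring.
Qed.

End Parallel.

Section YangMills.
Variables (R : realType) (p q : nat).
Local Notation n := (p + q)%N.
Variables h Cf : 'I_n -> 'rV[R]_n -> Cl R p q.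
Hypothesis h_clifford : clifford_field_vector h.
Hypothesis Cf_clS : forall mu x, in_clS (Cf mu x).
Hypothesis h_C2 : forall mu, C2Cl (h mu).
Hypothesis Cf_C2 : forall mu, C2Cl (Cf mu).
Hypothesis lower_h_covconst : forall mu rho x,
  clpartial mu (lower h rho) x - clcomm (Cf mu x) (lower h rho x) = 0.

Lemma lower_parallel rho : parallel Cf (lower h rho).
Proof.
move=> mu x; have dh := C2Cl_is_clpartial mu x (h_C2 rho).
have dlh := is_clpartialZ (eta R rho) dh.
have /eqP := lower_h_covconst mu rho x.
by rewrite (clpartial_val dlh) subr_eq0 => /eqP <-.
Qed.

Lemma h_parallel rho : parallel Cf (h rho).
Proof.
have -> : h rho = fun x => eta R rho *: lower h rho x.
  by apply/funext => x; rewrite scalerA eta_sqr scale1r.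
exact/parallelZ/lower_parallel.
Qed.

Lemma curvature_eq0 mu nu x : YM_G Cf mu nu x = 0.
Proof.
have [hA htop] := h_clifford x.
apply: (gen_centralizer_in_clS_eq0 hA htop); last exact: in_clS_curvature.
move=> rho; apply/eqP; rewrite -subr_eq0 -clcommE.
by rewrite (parallel_curvature Cf_C2 mu nu x (h_C2 rho) (h_parallel rho)).
Qed.

Variable sigma : R[i].
Local Notation B := (YM_B sigma h Cf).

Lemma YM_GupE mu nu :
  YM_Gup B mu nu = fun x => - sigma ^+ 2 *: clcomm (h mu x) (h nu x).
Proof.
apply/funext => x; rewrite /YM_Gup (YM_G_shift Cf_C2); last first.
  by move=> rho; exact/parallelZ/lower_parallel.
rewrite curvature_eq0 sub0r !(clcommZl, clcommZr) scalerN -scaleNr !scalerA.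
congr (_ *: _); ring: (eta_sqr R mu) (eta_sqr R nu).
Qed.

Lemma YM_divergence_term mu nu x :
  clpartial mu (YM_Gup B mu nu) x - clcomm (B mu x) (YM_Gup B mu nu x) =
  (4 * sigma ^+ 3 * (mu != nu)%:R) *: h nu x.
Proof.
rewrite YM_GupE parallel_covariant_shift; last first.
  by apply/parallelZ/parallel_clcomm; exact: h_parallel.
rewrite !(clcommZl, clcommZr) (gen_double_clcomm (h_clifford x).1).
rewrite -scaleNr !scalerA; congr (_ *: _); ring: (eta_sqr R mu).
Qed.

End YangMills.

Theorem theorem9 (R : realType) (p q : nat)
  (h Cf : 'I_(p + q) -> 'rV[R]_(p + q) -> Cl R p q)
  (sigma eps : R[i]) :
  clifford_field_vector h ->
  (forall mu x, in_clS (h mu x)) ->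
  (forall mu x, in_clS (Cf mu x)) ->
  (forall mu, C2Cl (h mu)) ->
  (forall mu, C2Cl (Cf mu)) ->
  (forall mu rho x,
     clpartial mu (lower h rho) x - clcomm (Cf mu x) (lower h rho x) = 0) ->
  eps = 4 * ((p + q)%:R - 1) * sigma ^+ 3 ->
  let B := YM_B sigma h Cf in
  let G := YM_G B in
  (forall mu x, in_clS (B mu x)) /\
  (forall mu nu x,
     clpartial mu (B nu) x - clpartial nu (B mu) x - clcomm (B mu x) (B nu x)
       = G mu nu x) /\
  (forall nu x,
     \sum_(mu < p + q)
        (clpartial mu (YM_Gup B mu nu) x - clcomm (B mu x) (YM_Gup B mu nu x))
       = eps *: h nu x).
Proof.
move=> h_clifford hS CfS h2 Cf2 h_covconst epsE B G; split; [|split=> // nu x].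
  by move=> mu x; apply: in_clSD => //; do 2 apply: in_clSZ.
under eq_bigr do rewrite YM_divergence_term //.
rewrite -scaler_suml -mulr_sumr sum_neq_natr card_ord epsE.
by congr (_ *: _); ring.
Qed.
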